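(* For a positive integer $n$, the adjacency matrix of the unitary Cayley graph $X_n$ has exactly four distinct eigenvalues if and only if $n$ is the product of two distinct primes.
   Context: The unitary Cayley graph $X_n$ is the graph with vertex set $\mathbb{Z}_n=\{0,1,\ldots,n-1\}$ in which $i$ and $j$ are adjacent if and only if $\gcd(i-j,n)=1$. *)

(* Defs.v *)
From mathcomp Require Import all_boot all_order all_algebra.

Set Implicit Arguments.
Unset Strict Implicit.
Unset Printing Implicit Defensive.

Import GRing.Theory.
Local Open Scope ring_scope.

(* The difference is taken in int. For n = 1 the rule gcd(i - j, n) = 1 holds  *)
(* at i = j = 0, so the single vertex of X_1 carries a loop; for n > 1 there   *)
(* are no loops.                                                              *)
Definition unitary_cayley (n : nat) : rel 'I_n :=
  fun i j => gcdz (i%:Z - j%:Z) n%:Z == 1.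

Definition adjacency_mx (R : nzRingType) (n : nat) (e : rel 'I_n) : 'M[R]_n :=
  \matrix_(i, j) (e i j)%:R.

Definition has_exactly_distinct_eigenvalues
    (F : fieldType) (n : nat) (A : 'M[F]_n) (k : nat) : Prop :=
  exists s : seq F,
    [/\ uniq s, size s = k & forall a : F, (a \in s) = eigenvalue A a].

(* Main.v *)
Require Import Defs.
From mathcomp Require Import all_boot all_order all_algebra.
From mathcomp Require Import zify ring.

(** By the Chinese remainder theorem the adjacency matrix of [X_ab] is the
    tensor product of those of [X_a] and [X_b] when [a] and [b] are coprime,
    and [X_(p^k)] is the complete multipartite graph whose [p] parts, of size
    [m = p^(k-1)], are the residue classes mod [p]; its eigenvalues are
    [m(p-1)], [-m], and [0] if [m > 1].  Hence a prime power gives at most three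
    eigenvalues, three distinct prime divisors give at least five, and two give
    four nonzero ones, together with [0] unless [n] is squarefree. *)

Set Implicit Arguments.
Unset Strict Implicit.
Unset Printing Implicit Defensive.

Import Order.TTheory GRing.Theory Num.Theory.
Local Open Scope ring_scope.

(** * Eigenvectors as functions on the vertices, and counting eigenvalues *)

Section AdjacencyEigenvalues.

Variables (F : fieldType) (n : nat).

(** [eigenvalue] refers to row vectors acting from the left, so the sum runs over the first argument
    of [e]. *)
Lemma adjacency_eigenvalueP (e : rel 'I_n) (a : F) :
  eigenvalue (adjacency_mx F e) a <->
  exists f : 'I_n -> F, (exists i, f i != 0) /\
    forall j, \sum_(i | e i j) f i = a * f j.
Proof.
have mulE (v : 'rV[F]_n) j :
    (v *m adjacency_mx F e) 0 j = \sum_(i | e i j) v 0 i.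
  rewrite mxE [RHS]big_mkcond; apply: eq_bigr => i _.
  by rewrite mxE; case: (e i j); rewrite ?mulr1 ?mulr0.
split=> [/eigenvalueP[v vA v0] | [f [[i fi] fA]]].
  exists (v 0); split; last by move=> j; rewrite -mulE vA mxE.
  by apply/rV0Pn.
apply/eigenvalueP; exists (\row_j f j); last first.
  by apply/rV0Pn; exists i; rewrite mxE.
apply/rowP => j; rewrite mulE !mxE -fA.
by apply: eq_bigr => k _; rewrite mxE.
Qed.

Lemma distinct_eigenvalues_le (A : 'M[F]_n) k (l : seq F) :
  has_exactly_distinct_eigenvalues A k ->
  (forall a, eigenvalue A a -> a \in l) -> (k <= size l)%N.
Proof.
move=> [s [us <- sA]] lA; apply: uniq_leq_size => // a.
by rewrite sA; apply: lA.
Qed.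

Lemma distinct_eigenvalues_ge (A : 'M[F]_n) k (l : seq F) :
  has_exactly_distinct_eigenvalues A k ->
  uniq l -> {in l, forall a, eigenvalue A a} -> (size l <= k)%N.
Proof.
move=> [s [us <- sA]] ul lA; apply: uniq_leq_size => // a /lA.
by rewrite sA.
Qed.

End AdjacencyEigenvalues.

(** * Arithmetic of the adjacency relation *)

Definition coprime_diff (n i j : nat) : bool := coprime `|i%:Z - j%:Z|%N n.

(** Adjacency is moved from ['I_n] to natural numbers, so that the same pair can be tested modulo
    several divisors of [n] without casts. *)
Lemma unitary_cayleyE n (i j : 'I_n) : unitary_cayley i j = coprime_diff n i j.
Proof. by []. Qed.

Lemma coprime_diff_mod n i j :
  coprime_diff n (i %% n)%N (j %% n)%N = coprime_diff n i j.
Proof.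
have diffE x y : coprime_diff n x y = (gcdz (x%:Z - y%:Z) n%:Z == 1) by [].
rewrite !diffE -gcdz_modl -[in RHS]gcdz_modl -!modz_nat.
by rewrite modzDml -modzDmr modzNm modzDmr.
Qed.

Lemma coprime_diff_mul a b i j :
  coprime_diff (a * b) i j =
  coprime_diff a (i %% a) (j %% a) && coprime_diff b (i %% b) (j %% b).
Proof. by rewrite !coprime_diff_mod /coprime_diff coprimeMr. Qed.

Lemma coprime_diff_pfactor p k i j : prime p ->
  coprime_diff (p ^ k.+1) i j = (i != j %[mod p]).
Proof.
move=> p_pr; rewrite /coprime_diff coprime_pexpr // coprime_sym.
rewrite prime_coprime //; congr (~~ _).
have := eqz_mod_dvd p%:Z i%:Z j%:Z; rewrite !modz_nat eqz_nat => ->.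
by rewrite dvdzE.
Qed.

Lemma coprime_diff_prime p i j : prime p ->
  coprime_diff p i j = (i != j %[mod p]).
Proof. exact: (@coprime_diff_pfactor p 0 i j). Qed.

(** * Chinese remaindering and regularity *)

Section Spectrum.

Variable C : numClosedFieldType.

Definition cayley_eigenvalue (n : nat) (a : C) : bool :=
  eigenvalue (adjacency_mx C (@unitary_cayley n)) a.

Lemma cayley_eigenvalueP n a :
  cayley_eigenvalue n a <->
  exists f : 'I_n -> C, (exists i, f i != 0) /\
    forall j : 'I_n, \sum_(i < n | coprime_diff n i j) f i = a * f j.
Proof. exact: adjacency_eigenvalueP. Qed.

Lemma crt_bij a b (a_gt0 : (0 < a)%N) (b_gt0 : (0 < b)%N) : coprime a b ->
  bijective (fun k : 'I_(a * b) =>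
    (Ordinal (ltn_pmod k a_gt0), Ordinal (ltn_pmod k b_gt0))).
Proof.
move=> co_ab; apply: inj_card_bij; last by rewrite card_prod !card_ord.
move=> x y [ea eb]; apply/val_inj/eqP.
have /eqP : x == y %[mod a * b] by rewrite chinese_remainder // ea eb !eqxx.
by rewrite !modn_small // => exy; apply/eqP.
Qed.

(** Along [crt_bij] a function on the residues mod [a * b] becomes a function of two residues, and
    by [coprime_diff_mul] the neighbours of a pair are the pairs of neighbours. *)
Lemma cayley_eigenvalue_crt a b (x : C) :
  (0 < a)%N -> (0 < b)%N -> coprime a b ->
  cayley_eigenvalue (a * b) x <->
  exists w : 'I_a -> 'I_b -> C, (exists i j, w i j != 0) /\
    forall (i : 'I_a) (j : 'I_b), \sum_(i' < a | coprime_diff a i' i)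
      \sum_(j' < b | coprime_diff b j' j) w i' j' = x * w i j.
Proof.
move=> a_gt0 b_gt0 co_ab; have hbij := crt_bij a_gt0 b_gt0 co_ab.
set h := (X in bijective X) in hbij; have [g gK hK] := hbij.
have sumE (w : 'I_a -> 'I_b -> C) k :
  \sum_(i' < a | coprime_diff a i' (h k).1)
     \sum_(j' < b | coprime_diff b j' (h k).2) w i' j'
  = \sum_(i < a * b | coprime_diff (a * b) i k) w (h i).1 (h i).2.
  rewrite pair_big /= (reindex h) /=; last exact: onW_bij.
  by apply: eq_bigl => i; rewrite [RHS]coprime_diff_mul.
rewrite cayley_eigenvalueP; split=> [[f [[k fk] fA]] | [w [[i [j wij]] wA]]].
  exists (fun i j => f (g (i, j))); split.
    by exists (h k).1, (h k).2; move: fk; rewrite -{1}(gK k).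
  move=> i j; rewrite -fA.
  have := sumE (fun i j => f (g (i, j))) (g (i, j)); rewrite hK /= => ->.
  by apply: eq_bigr => l _; rewrite -[in RHS](gK l).
exists (fun k => w (h k).1 (h k).2); split.
  by exists (g (i, j)); rewrite hK.
by move=> k; rewrite -sumE wA.
Qed.

Lemma cayley_eigenvalueM a b (x y : C) :
  (0 < a)%N -> (0 < b)%N -> coprime a b ->
  cayley_eigenvalue a x -> cayley_eigenvalue b y ->
  cayley_eigenvalue (a * b) (x * y).
Proof.
move=> a_gt0 b_gt0 co_ab.
move=> /cayley_eigenvalueP[f [[i fi] fA]] /cayley_eigenvalueP[g [[j gj] gA]].
apply/cayley_eigenvalue_crt => //; exists (fun i j => f i * g j); split.
  by exists i, j; rewrite mulf_neq0.
move=> i0 j0; rewrite mulrACA -fA -gA mulr_suml.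
by apply: eq_bigr => k _; rewrite mulr_sumr.
Qed.

(** Translations make the graph regular, so the constant function is an eigenvector for the degree.
    This supplies a nonzero eigenvalue for a cofactor about which nothing else is known. *)
Lemma cayley_eigenvalue_degree n : (0 < n)%N ->
  exists2 d : nat, (0 < d)%N & cayley_eigenvalue n d%:R.
Proof.
move=> n_gt0; pose deg j := #|[pred i : 'I_n | coprime_diff n i j]|.
have mod_ord (i : nat) : (i %% n < n)%N by rewrite ltn_pmod.
pose o i := Ordinal (mod_ord i).
have degE (j : 'I_n) : deg j = deg 0%N.
  rewrite /deg; pose sh (i : 'I_n) := o (i + j)%N.
  have sh_inj : injective sh.
    move=> x y [] /eqP; rewrite eqn_modDr !modn_small // => /eqP exy.
    exact: val_inj.
  rewrite -!sum1_card (reindex sh) /=; last exact/onW_bij/injF_bij.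
  apply: eq_bigl => i; rewrite !inE /= -coprime_diff_mod modn_mod.
  by rewrite coprime_diff_mod /coprime_diff PoszD addrK subr0.
exists (deg 0%N).
  (* The residue of 1 is a neighbour of 0; for [n = 1] it is 0 itself, through the loop. *)
  apply/card_gt0P; exists (o 1%N); rewrite !inE /=.
  have := coprime_diff_mod n 1 0; rewrite mod0n => ->.
  rewrite /coprime_diff subr0.
  exact: coprime1n.
apply/cayley_eigenvalueP; exists (fun=> 1); split.
  by exists (o 0%N); rewrite oner_eq0.
by move=> j; rewrite sumr_const mulr1 -(degE j).
Qed.

Lemma card_residue_class p m c : (0 < p)%N ->
  #|[pred j : 'I_(p * m) | j == c %[mod p]]| = m.
Proof.
move=> p_gt0; rewrite -sum1_card.
rewrite -(big_mkord (fun j => j == c %[mod p]) (fun=> 1%N)).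
(* Each further block of [p] consecutive integers meets the class of [c] exactly once. *)
elim: m => [|m IHm]; first by rewrite muln0 big_geq.
rewrite mulnS addnC (@big_cat_nat _ _ _ (p * m)%N) ?leq_addr //= IHm.
rewrite -[RHS]addn1; congr (_ + _)%N.
rewrite -{1}[(p * m)%N]add0n big_addn addKn big_mkord.
rewrite (big_pred1 (Ordinal (ltn_pmod c p_gt0))) // => j.
by rewrite addnC mulnC modnMDl /= modn_small.
Qed.

(** * The spectrum for a prime power *)

Section PrimePower.

Variables (p k : nat).
Hypothesis p_pr : prime p.

Let p_gt0 : (0 < p)%N := prime_gt0 p_pr.
Let m := (p ^ k)%N.

(** The neighbours of [j] are the vertices outside its class mod [p], so the sum over them is the
    total minus a class sum. *)
Lemma pfactor_eigenvalueP a :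
  cayley_eigenvalue (p ^ k.+1) a <->
  exists f : 'I_(p * m) -> C, (exists i, f i != 0) /\
    forall j : 'I_(p * m),
      \sum_i f i - \sum_(i < p * m | i == j %[mod p]) f i = a * f j.
Proof.
rewrite cayley_eigenvalueP expnS -/m.
have sumE (f : 'I_(p * m) -> C) (j : 'I_(p * m)) :
    \sum_(i < p * m | coprime_diff (p * m) i j) f i =
    \sum_i f i - \sum_(i < p * m | i == j %[mod p]) f i.
  rewrite [\sum_i f i](bigID (fun i : 'I__ => i == j %[mod p])) /= addrC addrK.
  by apply: eq_bigl => i; rewrite -(coprime_diff_pfactor k) ?expnS.
by split=> [] [f [f0 fA]]; exists f; split=> // j; rewrite -fA sumE.
Qed.

Lemma sum_residue_class c : \sum_(j < p * m | j == c %[mod p]) 1 = m%:R :> C.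
Proof. by rewrite sumr_const card_residue_class. Qed.

Lemma pfactor_eigenvalue_degree :
  cayley_eigenvalue (p ^ k.+1) (m%:R * p.-1%:R).
Proof.
have n_gt0 : (0 < p * m)%N by rewrite muln_gt0 p_gt0 expn_gt0 p_gt0.
apply/pfactor_eigenvalueP; exists (fun=> 1); split.
  by exists (Ordinal n_gt0); rewrite oner_eq0.
move=> j; rewrite sum_residue_class sumr_const card_ord mulr1.
by rewrite -{1}(prednK p_gt0) mulSn natrD natrM addrC addKr mulrC.
Qed.

Lemma pfactor_eigenvalue_neg : cayley_eigenvalue (p ^ k.+1) (- m%:R).
Proof.
have n_gt0 : (0 < p * m)%N by rewrite muln_gt0 p_gt0 expn_gt0 p_gt0.
have p_gt1 := prime_gt1 p_pr.
(* This function has total 0 and is constant on classes, so each class sum is [m] times its value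
   there. *)
pose f (i : nat) : C := (i == 0 %[mod p])%:R - (i == 1 %[mod p])%:R.
have f_mod i j : i = j %[mod p] -> f i = f j by rewrite /f => ->.
have classE (c : nat) :
    \sum_(i < p * m) (i == c %[mod p])%:R = m%:R :> C.
  rewrite -(sum_residue_class c) [RHS]big_mkcond.
  by apply: eq_bigr => i _; case: eqP.
apply/pfactor_eigenvalueP; exists f; split.
  exists (Ordinal n_gt0).
  by rewrite /f /= mod0n modn_small // subr0 oner_eq0.
move=> j; rewrite sumrB !classE subrr sub0r mulNr -(sum_residue_class j).
rewrite mulr_suml; congr (- _).
by apply: eq_bigr => i /eqP /f_mod ->; rewrite mul1r.
Qed.

Lemma pfactor_eigenvalue0 : (0 < k)%N -> cayley_eigenvalue (p ^ k.+1) 0.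
Proof.
move=> k_gt0.
have n_gt0 : (0 < p * m)%N by rewrite muln_gt0 p_gt0 expn_gt0 p_gt0.
have p_gt1 := prime_gt1 p_pr.
have p_lt : (p < p * m)%N by rewrite ltn_Pmulr // -(exp1n k) ltn_exp2r.
(* As [k > 0], the class of 0 contains the two distinct vertices 0 and [p]; the difference of their
   indicators has zero total and zero class sums. *)
pose x := Ordinal n_gt0; pose y := Ordinal p_lt.
have xy : x != y by rewrite -val_eqE /= neq_ltn p_gt0.
have sum_delta (P : pred 'I_(p * m)) z :
    \sum_(i | P i) (i == z)%:R = (P z)%:R :> C.
  rewrite big_mkcond (bigD1 z) //= eqxx big1 ?addr0; last first.
    by move=> i /negPf ->; case: (P i).
  by case: (P z).
apply/pfactor_eigenvalueP.
exists (fun i => (i == x)%:R - (i == y)%:R); split.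
  by exists x; rewrite eqxx (negPf xy) subr0 oner_eq0.
by move=> j; rewrite !sumrB !sum_delta /= modnn mod0n !subrr mul0r.
Qed.

(** Summing the eigenvector equation over all vertices, and over one class, gives equations for the
    total [S] and the class sums [T]. The first nonzero one among [S], [T i0], [f i0] determines
    [a]. *)
Lemma pfactor_eigenvalue_mem a : cayley_eigenvalue (p ^ k.+1) a ->
  a \in [:: m%:R * p.-1%:R; - m%:R; 0].
Proof.
move=> /pfactor_eigenvalueP[f [[i0 fi0] fA]].
pose S := \sum_i f i; pose T c := \sum_(i < p * m | i == c %[mod p]) f i.
have sumT : \sum_(j < p * m) T j = m%:R * S.
  rewrite /T; under eq_bigr do rewrite big_mkcond.
  rewrite exchange_big mulr_sumr; apply: eq_bigr => i _.
  rewrite -(sum_residue_class i) mulr_suml [RHS]big_mkcond.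
  by apply: eq_bigr => j _; rewrite eq_sym mul1r.
have eqS : a * S = (m%:R * p.-1%:R) * S.
  rewrite mulr_sumr; under eq_bigr do rewrite -fA.
  rewrite sumrB -/S sumT sumr_const card_ord -[S *+ _]mulr_natl -mulrBl.
  rewrite -{1}(prednK p_gt0) mulSn natrD natrM addrC addKr.
  by rewrite [_ * p.-1%:R]mulrC.
have eqT c : a * T c = m%:R * (S - T c).
  rewrite mulr_sumr; under eq_bigr do rewrite -fA.
  rewrite -(sum_residue_class c) mulr_suml.
  apply: eq_bigr => i /eqP eic; rewrite mul1r -/S; congr (_ - _).
  by apply: eq_bigl => j; rewrite eic.
rewrite !inE; have [S0|S_neq0] := eqVneq S 0; last first.
  by move/(mulIf S_neq0): eqS => ->; rewrite eqxx.
have [T0|T_neq0] := eqVneq (T i0) 0; last first.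
  move: (eqT i0); rewrite S0 sub0r mulrN -mulNr => /(mulIf T_neq0) ->.
  by rewrite eqxx orbT.
move: (fA i0); rewrite -/S -/(T i0) S0 T0 subrr => /esym/eqP.
by rewrite mulf_eq0 (negPf fi0) orbF => ->; rewrite !orbT.
Qed.

End PrimePower.

(** * Upper bound for a product of two primes *)

Lemma prime_pair_eigenvalue_mem p q a : prime p -> prime q -> p != q ->
  cayley_eigenvalue (p * q) a ->
  a \in [:: p.-1%:R * q.-1%:R; - q.-1%:R; - p.-1%:R; 1].
Proof.
move=> p_pr q_pr npq.
have predE r : prime r -> r.-1%:R = r%:R - 1 :> C.
  by move=> /prime_gt0 /prednK {2}<-; rewrite -natr1 addrK.
rewrite (predE p) // (predE q) //.
case/cayley_eigenvalue_crt; rewrite ?prime_gt0 //.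
  by rewrite prime_coprime // dvdn_prime2.
move=> w [[x [y wxy]] wA].
have ordE r (i j : 'I_r) : prime r -> coprime_diff r i j = (i != j).
  by move=> r_pr; rewrite coprime_diff_prime // !modn_small.
pose R i := \sum_j w i j; pose T j := \sum_i w i j; pose S := \sum_i R i.
have ST : S = \sum_j T j by rewrite /S /R exchange_big.
(* Inclusion-exclusion: the neighbours of [(i, j)] are the pairs differing from it in both
   coordinates. Summing this over a row, a column or everything gives [eqR], [eqT], [eqS], and the
   first nonzero one among [S], [R x], [T y], [w x y] determines [a]. *)
have eqw i j : S - T j - (R i - w i j) = a * w i j.
  rewrite -wA (eq_bigl (fun i' => i' != i)); last by move=> i'; rewrite ordE.
  rewrite (eq_bigr (fun i' => R i' - w i' j)); last first.
    move=> i' _.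
    rewrite (eq_bigl (fun j' => j' != j)); last by move=> j'; rewrite ordE.
    by rewrite /R [in RHS](bigD1 j) //= [w i' j + _]addrC addrK.
  by rewrite /S /T -sumrB [in LHS](bigD1 i) //= [_ + \sum_(_ | _) _]addrC addrK.
have eqR i : a * R i = (q%:R - 1) * (S - R i).
  rewrite mulr_sumr; under eq_bigr do rewrite -eqw.
  rewrite !sumrB !sumr_const card_ord -ST -/(R i).
  rewrite -[S *+ _]mulr_natl -[R i *+ _]mulr_natl; ring.
have eqT j : a * T j = (p%:R - 1) * (S - T j).
  rewrite mulr_sumr; under eq_bigr do rewrite -eqw.
  rewrite !sumrB !sumr_const card_ord -/S -/(T j).
  rewrite -[S *+ _]mulr_natl -[T j *+ _]mulr_natl; ring.
have eqS : a * S = (p%:R - 1) * (q%:R - 1) * S.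
  rewrite {1}/S mulr_sumr; under eq_bigr do rewrite eqR.
  rewrite -mulr_sumr sumrB sumr_const card_ord -/S -[S *+ _]mulr_natl; ring.
rewrite !inE; have [S0|S_neq0] := eqVneq S 0; last first.
  by move/(mulIf S_neq0): eqS => ->; rewrite eqxx.
have [R0|R_neq0] := eqVneq (R x) 0; last first.
  move: (eqR x); rewrite S0 sub0r mulrN -mulNr => /(mulIf R_neq0) ->.
  by rewrite eqxx orbT.
have [T0|T_neq0] := eqVneq (T y) 0; last first.
  move: (eqT y); rewrite S0 sub0r mulrN -mulNr => /(mulIf T_neq0) ->.
  by rewrite eqxx !orbT.
move: (eqw x y); rewrite S0 R0 T0 !sub0r oppr0 opprK add0r -[LHS]mul1r.
by move=> /(mulIf wxy) <-; rewrite eqxx !orbT.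
Qed.

(** * Distinctness of the candidate eigenvalues *)

Lemma uniq_scaled_intr (K : C) (l : seq int) :
  K != 0 -> uniq l -> uniq [seq K * z%:~R | z <- l].
Proof.
move=> K0 ul; rewrite map_inj_uniq // => x y /(mulfI K0) /eqP.
by rewrite eqr_int => /eqP.
Qed.

(** Here [a] and [b] stand for [p.-1] and [q.-1]. Through [uniq_scaled_intr], distinctness only has
    to be checked on integers. *)
Lemma uniq_two_primes (a b : nat) : (0 < a)%N -> (0 < b)%N -> a != b ->
  uniq [:: a%:Z * b%:Z; - b%:Z; - a%:Z; 1; 0].
Proof.
move=> a0 b0 ab; have ab1 : (1 < a * b)%N by nia.
by rewrite /= !inE -PoszM; lia.
Qed.

(** The two positive entries differ because [b * c > 1]; the three negative ones because [a], [b],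
    [c] are pairwise distinct. *)
Lemma uniq_three_primes (a b c : nat) :
    (0 < a)%N -> (0 < b)%N -> (0 < c)%N -> a != b -> a != c -> b != c ->
  uniq [:: a%:Z * b%:Z * c%:Z; - (b%:Z * c%:Z); - (a%:Z * c%:Z);
           - (a%:Z * b%:Z); a%:Z].
Proof.
move=> a0 b0 c0 ab ac bc.
have bc1 : (1 < b * c)%N by nia.
have h0 : (a < a * b * c)%N by nia.
have h1 : (b * c != a * c)%N by rewrite eqn_pmul2r // eq_sym.
have h2 : (b * c != a * b)%N by rewrite mulnC eqn_pmul2r // eq_sym.
have h3 : (a * c != a * b)%N by rewrite eqn_pmul2l // eq_sym.
have h4 : (0 < a * c)%N by rewrite muln_gt0 a0.
have h5 : (0 < a * b)%N by rewrite muln_gt0 a0.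
rewrite -!PoszM.
(* With the products generalized to variables, the goal is linear. *)
move: (a * b * c)%N (b * c)%N (a * c)%N (a * b)%N h0 h1 h2 h3 h4 h5 bc1.
by move=> x y z t *; rewrite /= !inE; lia.
Qed.

(** * Splitting off prime powers *)

Lemma pfactor_split n : (1 < n)%N -> exists p k m,
  [/\ prime p, (0 < m)%N, coprime p m & n = (p ^ k.+1 * m)%N].
Proof.
move=> n_gt1; have n_gt0 := ltnW n_gt1; have p_pr := pdiv_prime n_gt1.
have [m co_m def_n] := pfactor_coprime p_pr n_gt0.
have k_gt0 : (0 < logn (pdiv n) n)%N.
  by rewrite logn_gt0 mem_primes p_pr n_gt0 pdiv_dvd.
exists (pdiv n), (logn (pdiv n) n).-1, m; rewrite prednK // [LHS]def_n mulnC.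
by split=> //; move: n_gt0; rewrite [in X in X -> _]def_n muln_gt0 => /andP[].
Qed.

(** These are the products of the degree or [-m] eigenvalue of one factor with that of the other,
    with the common scale [p ^ k * q ^ l] pulled out. *)
Lemma two_pfactor_eigenvalues p q k l :
    prime p -> prime q -> p != q ->
  {in [seq ((p ^ k)%:R * (q ^ l)%:R) * z%:~R |
        z <- [:: p.-1%:Z * q.-1%:Z; - q.-1%:Z; - p.-1%:Z; 1]],
    forall a : C, cayley_eigenvalue (p ^ k.+1 * q ^ l.+1) a}.
Proof.
move=> p_pr q_pr npq.
have co : coprime (p ^ k.+1) (q ^ l.+1).
  by rewrite coprimeXl // coprimeXr // prime_coprime // dvdn_prime2.
have pow_gt0 r j : prime r -> (0 < r ^ j)%N.
  by move=> /prime_gt0 r0; rewrite expn_gt0 r0.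
have eigM x y := @cayley_eigenvalueM _ _ x y
  (pow_gt0 p k.+1 p_pr) (pow_gt0 q l.+1 q_pr) co.
have dp := pfactor_eigenvalue_degree k p_pr.
have dq := pfactor_eigenvalue_degree l q_pr.
have mp := pfactor_eigenvalue_neg k p_pr.
have mq := pfactor_eigenvalue_neg l q_pr.
move=> a; rewrite /= !inE !intrM !mulrNz; case/or4P => /eqP ->.
- by have := eigM _ _ dp dq; rewrite mulrACA.
- by have := eigM _ _ mp dq; rewrite !mulNr mulrN mulrA.
- by have := eigM _ _ dp mq; rewrite !mulrN mulrAC.
- by have := eigM _ _ mp mq; rewrite mulrNN mulr1.
Qed.

End Spectrum.

(** * The characterization, by the number of distinct prime divisors *)

Theorem theorem4p8 (C : numClosedFieldType) (n : nat) (n_gt0 : (0 < n)%N) :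
  has_exactly_distinct_eigenvalues (adjacency_mx C (@unitary_cayley n)) 4 <->
  exists p q : nat, [/\ prime p, prime q, p != q & n = (p * q)%N].
Proof.
have pred_gt0 r : prime r -> (0 < r.-1)%N by case: r => [|[]].
have pred_neq r s : prime r -> prime s -> r != s -> r.-1 != s.-1.
  by case: r => // r; case: s.
have powR_neq0 r j : prime r -> (r ^ j)%:R != 0 :> C.
  by move=> /prime_gt0 r0; rewrite pnatr_eq0 -lt0n expn_gt0 r0.
have pow_gt0 r j : prime r -> (0 < r ^ j)%N.
  by move=> /prime_gt0 r0; rewrite expn_gt0 r0.
split=> [four | [p [q [p_pr q_pr npq def_n]]]]; last first.
  have nP : (p ^ 1 * q ^ 1)%N = n by rewrite !expn1.
  have := two_pfactor_eigenvalues (C := C) (k := 0) (l := 0) p_pr q_pr npq.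
  rewrite nP !expn0; set l := [seq _ | z <- _] => l_eig.
  exists l; split=> //.
    apply: uniq_scaled_intr; first by rewrite mulr1 oner_eq0.
    (* The four eigenvalues are the five-element list without its final 0. *)
    have := uniq_two_primes (pred_gt0 p p_pr) (pred_gt0 q q_pr)
      (pred_neq _ _ p_pr q_pr npq).
    rewrite -[[:: _, _, _, _ & _]]/([:: _; _; _; _] ++ _) cat_uniq.
    by move=> /andP[].
  move=> a; apply/idP/idP => [/l_eig // | ].
  rewrite -/(cayley_eigenvalue n a) def_n.
  move=> /(prime_pair_eigenvalue_mem p_pr q_pr npq).
  by rewrite /l /= !inE !mul1r !intrM !mulrNz.
have [n1|n_gt1] : n = 1%N \/ (1 < n)%N by case: (n) n_gt0 => [|[|]]; auto.
  (* The looped vertex has the single eigenvalue 1. *)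
  subst n; suff : (4 <= 1)%N by [].
  apply: (distinct_eigenvalues_le (l := [:: 1]) four) => a.
  move=> /adjacency_eigenvalueP[f [[i fi] /(_ i)]].
  rewrite big_mkcond big_ord1 unitary_cayleyE /coprime_diff coprimen1 [i]ord1.
  rewrite [i]ord1 in fi; rewrite -{1}[f _]mul1r => /(mulIf fi) <-.
  exact: mem_head.
have [p [k [m [p_pr m_gt0 co_pm def_n]]]] := pfactor_split n_gt1.
have [m1|m_gt1] : m = 1%N \/ (1 < m)%N by case: (m) m_gt0 => [|[|]]; auto.
  subst n m; rewrite muln1 in four.
  by have := distinct_eigenvalues_le four (pfactor_eigenvalue_mem p_pr).
have [q [l [m' [q_pr m'_gt0 co_qm' def_m]]]] := pfactor_split m_gt1.
move: co_pm; rewrite def_m coprimeMr coprime_pexpr // => /andP[co_pq co_pm'].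
have npq : p != q by rewrite prime_coprime // dvdn_prime2 in co_pq.
have [m'1|m'_gt1] : m' = 1%N \/ (1 < m')%N by case: (m') m'_gt0 => [|[|]]; auto.
  have {}def_n : n = (p ^ k.+1 * q ^ l.+1)%N by rewrite def_n def_m m'1 muln1.
  (* Either both exponents are 1 and [n = p * q], or 0 is a fifth eigenvalue. *)
  have [/eqP kl0|kl_gt0] := eqVneq (k + l)%N 0%N.
    move: kl0; rewrite addn_eq0 => /andP[/eqP k0 /eqP l0].
    by exists p, q; rewrite def_n k0 l0.
  subst n; suff : (5 <= 4)%N by [].
  pose z5 := [:: p.-1%:Z * q.-1%:Z; - q.-1%:Z; - p.-1%:Z; 1; 0].
  pose l5 := [seq ((p ^ k)%:R * (q ^ l)%:R) * z%:~R : C | z <- z5].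
  apply: (distinct_eigenvalues_ge (l := l5) four).
    apply: uniq_scaled_intr; rewrite ?mulf_neq0 ?powR_neq0 //.
    by rewrite uniq_two_primes ?pred_gt0 ?pred_neq.
  move=> a; rewrite /l5 /z5 -[[:: _; _; _; _; 0]]/([:: _; _; _; _] ++ [:: 0]).
  rewrite map_cat mem_cat.
  move=> /orP[/(two_pfactor_eigenvalues p_pr q_pr npq) // | ].
  rewrite inE mulr0 => /eqP ->.
  have eigM x y := @cayley_eigenvalueM C _ _ x y
    (pow_gt0 p k.+1 p_pr) (pow_gt0 q l.+1 q_pr).
  have co : coprime (p ^ k.+1) (q ^ l.+1) by rewrite coprimeXl // coprimeXr.
  (* The eigenvalue 0 comes from a factor with exponent at least 2, multiplied by any eigenvalue of
     the other. *)
  have [k0|k_gt0] := posnP k.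
    have l_gt0 : (0 < l)%N by rewrite lt0n; move: kl_gt0; rewrite k0.
    have := eigM _ _ co (pfactor_eigenvalue_neg C k p_pr)
      (pfactor_eigenvalue0 C q_pr l_gt0).
    by rewrite mulr0.
  have := eigM _ _ co (pfactor_eigenvalue0 C p_pr k_gt0)
    (pfactor_eigenvalue_neg C l q_pr).
  by rewrite mul0r.
have [r [j [m'' [r_pr m''_gt0 co_rm'' def_m']]]] := pfactor_split m'_gt1.
move: co_pm' co_qm'; rewrite def_m' !coprimeMr !coprime_pexpr //.
move=> /andP[co_pr co_pm''] /andP[co_qr co_qm''].
have npr : p != r by rewrite prime_coprime // dvdn_prime2 in co_pr.
have nqr : q != r by rewrite prime_coprime // dvdn_prime2 in co_qr.
have [d d_gt0 d_eig] := cayley_eigenvalue_degree C m''_gt0.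
(* The common scale of the products below; the remaining cofactor [m''] always contributes its
   degree [d]. *)
pose K : C := (p ^ k)%:R * (q ^ l)%:R * (r ^ j)%:R * d%:R.
have K_neq0 : K != 0 by rewrite !mulf_neq0 ?powR_neq0 // pnatr_eq0 -lt0n.
have eig3 (x y z : C) : cayley_eigenvalue (p ^ k.+1) x ->
    cayley_eigenvalue (q ^ l.+1) y -> cayley_eigenvalue (r ^ j.+1) z ->
    cayley_eigenvalue n (x * (y * (z * d%:R))).
  move=> hx hy hz; rewrite def_n def_m def_m'.
  have co1 : coprime (r ^ j.+1) m'' by rewrite coprimeXl.
  have co2 : coprime (q ^ l.+1) (r ^ j.+1 * m'').
    by rewrite coprimeMr !coprimeXl // coprimeXr.
  have co3 : coprime (p ^ k.+1) (q ^ l.+1 * (r ^ j.+1 * m'')).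
    by rewrite !coprimeMr !coprimeXl // coprimeXr.
  apply: cayley_eigenvalueM => //; rewrite ?muln_gt0 ?m''_gt0 ?pow_gt0 //.
  apply: cayley_eigenvalueM => //; rewrite ?muln_gt0 ?m''_gt0 ?pow_gt0 //.
  by apply: cayley_eigenvalueM => //; rewrite ?pow_gt0.
suff : (5 <= 4)%N by [].
(* Five of the eight choices: no negative eigenvalue, one at [p], [q] or [r], and finally one at
   both [q] and [r]. *)
pose z5 := [:: p.-1%:Z * q.-1%:Z * r.-1%:Z; - (q.-1%:Z * r.-1%:Z);
  - (p.-1%:Z * r.-1%:Z); - (p.-1%:Z * q.-1%:Z); p.-1%:Z].
apply: (distinct_eigenvalues_ge (l := [seq K * z%:~R | z <- z5]) four).
  by apply: uniq_scaled_intr; rewrite // uniq_three_primes ?pred_gt0 ?pred_neq.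
have dp := pfactor_eigenvalue_degree C k p_pr.
have dq := pfactor_eigenvalue_degree C l q_pr.
have dr := pfactor_eigenvalue_degree C j r_pr.
have mp := pfactor_eigenvalue_neg C k p_pr.
have mq := pfactor_eigenvalue_neg C l q_pr.
have mr := pfactor_eigenvalue_neg C j r_pr.
move=> a; rewrite /z5 /= !inE !mulrNz !intrM.
have cast (b c : C) : b = c -> cayley_eigenvalue n b -> cayley_eigenvalue n c.
  by move=> ->.
case/or4P => [/eqP->|/eqP->|/eqP->|/orP[/eqP->|/eqP->]].
- by apply: cast (eig3 _ _ _ dp dq dr); rewrite /K; ring.
- by apply: cast (eig3 _ _ _ mp dq dr); rewrite /K; ring.
- by apply: cast (eig3 _ _ _ dp mq dr); rewrite /K; ring.
- by apply: cast (eig3 _ _ _ dp dq mr); rewrite /K; ring.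
- by apply: cast (eig3 _ _ _ dp mq mr); rewrite /K; ring.
Qed.
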